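(* Let $n$ be a positive integer, let $Q\in \mathbb{R}^{n \times n}$ be a square real matrix, and let $x=(x_1, \dots, x_n)$ be a vector of binary variables. Let $E$ be the edge set returned by the order-extraction algorithm (described in the context) run with $Q$ as its input. Then the graph $G=(V, E)$ with node set $V=\{x_1, \dots, x_n\}$ is a directed acyclic graph, i.e., a partial order of the variables $x$. Moreover, $G$ is valid with respect to minimization of the function $\phi: B_n\to\mathbb{R}$, $\phi(x) = x^\top Q x$.
   Context: $B_n := \{0,1\}^n$. A partial order of $n$ binary variables $x=(x_1,\dots,x_n)$ is a directed acyclic graph $G=(V,E)$ with vertex set $V=\{x_1,\dots,x_n\}$ and edge set $E\subset V\times V$. Here, as vertices, $x_1,\dots,x_n$ are just symbols (equivalently, the indices $1,\dots,n$), while for a vector $x\in B_n$, $x_i\in\{0,1\}$ denotes its $i$-th entry. The subset of $B_n$ ordered by $G$ is $$B_n^G := \{ x\in B_n \mid \forall (x_i, x_j)\in E,\ x_i=1 \Rightarrow x_j=1 \}.$$ The partial order $G$ is valid with respect to minimization of $\phi: B_n\to\mathbb{R}$ if $\min\{\phi(x) \mid x \in B_n\} = \min\{\phi(x) \mid x \in B_n^G\}$. Order-extraction algorithm. Input: $Q\in\mathbb{R}^{n\times n}$. Output: a set $E\subset V\times V$. 1. Set $a \leftarrow Q + Q^\top$ and $E \leftarrow \varnothing$. 2. For $i=1,2,\dots,n$ (outer loop, in this order) and for $j=1,2,\dots,n$ (inner loop, in this order): if $i\ne j$ and $(x_j,x_i)\notin E$ (for the current $E$) and $Q_{j,j}\le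 Q_{i,i}$, then do the following. (a) Set $S \leftarrow Q_{j,j}-Q_{i,i}$. (b) For $k=1,2,\dots,n$: if $k\ne i,j$ and $a_{j,k}>a_{i,k}$, set $S\leftarrow S + a_{j,k}-a_{i,k}$, and if now $S>0$, break out of the loop over $k$. (c) If $S\le 0$, set $E\leftarrow E\cup\{(x_i,x_j)\}$. 3. Return $E$. *)

(* Defs.v *)
From HB Require Import structures.
From mathcomp Require Import all_boot all_order all_algebra.
From mathcomp Require Import reals.

Set Implicit Arguments.
Unset Strict Implicit.
Unset Printing Implicit Defensive.

Import Order.TTheory GRing.Theory Num.Theory.
Local Open Scope ring_scope.

(* A graph on the variables x_1, ..., x_n is given by its edge set
   E : {set 'I_n * 'I_n}, the vertex x_i being represented by its (0-based)
   index; the space B_n of binary vectors is 'cV[bool]_n. *)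

Definition edge n (E : {set 'I_n * 'I_n}) : rel 'I_n :=
  fun i j => (i, j) \in E.

(* [cycle e c] also holds for c = [::]; for c = [:: i] it says that i carries
   a self-loop, so those are excluded too. *)
Definition acyclic n (E : {set 'I_n * 'I_n}) : Prop :=
  forall c : seq 'I_n, c != [::] -> ~~ cycle (edge E) c.

Definition ordered_vectors n (E : {set 'I_n * 'I_n}) : {set 'cV[bool]_n} :=
  [set x : 'cV[bool]_n |
    [forall i, forall j, ((i, j) \in E) ==> (x i 0 ==> x j 0)]].

Definition is_min_on (R : realType) n (phi : 'cV[bool]_n -> R)
    (A : {set 'cV[bool]_n}) (m : R) : Prop :=
  (exists2 x, x \in A & phi x = m) /\ (forall x, x \in A -> m <= phi x).

Definition valid_order (R : realType) n (E : {set 'I_n * 'I_n})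
    (phi : 'cV[bool]_n -> R) : Prop :=
  exists m : R,
    is_min_on phi [set: 'cV[bool]_n] m /\ is_min_on phi (ordered_vectors E) m.

Definition quad_form (R : realType) n (Q : 'M[R]_n) (x : 'cV[bool]_n) : R :=
  let v : 'cV[R]_n := map_mx (fun b : bool => b%:R) x in
  (v^T *m Q *m v) 0 0.

(* Final value of S after the loop over the indices k listed in ks; the loop
   stops early as soon as an update makes S positive. *)
Fixpoint scan (R : realType) n (a : 'M[R]_n) (i j : 'I_n) (S : R)
    (ks : seq 'I_n) : R :=
  if ks is k :: ks' then
    if [&& k != i, k != j & a i k < a j k] then
      let S' := S + a j k - a i k in
      if 0 < S' then S' else scan a i j S' ks'
    else scan a i j S ks'
  else S.

Definition extraction_step (R : realType) n (Q : 'M[R]_n) (i : 'I_n)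
    (E : {set 'I_n * 'I_n}) (j : 'I_n) : {set 'I_n * 'I_n} :=
  if [&& i != j, (j, i) \notin E & Q j j <= Q i i] then
    if scan (Q + Q^T) i j (Q j j - Q i i) (enum 'I_n) <= 0 then (i, j) |: E
    else E
  else E.

(* [enum 'I_n] lists the indices in increasing order. *)
Definition order_extraction (R : realType) n (Q : 'M[R]_n) :
    {set 'I_n * 'I_n} :=
  foldl (fun E i => foldl (extraction_step Q i) E (enum 'I_n))
    set0 (enum 'I_n).

(* Main.v *)
(* Put S(i,j) := Q_jj - Q_ii + sum_(k <> i,j) (a_jk - a_ik)^+, the value that
   the inner loop computes when it is not interrupted. Since a is symmetric, S
   satisfies the triangle inequality S(i,l) <= S(i,j) + S(j,l), so that
   S(i,j) <= 0 is a preorder on the variables. The algorithm returns exactly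
   the strict part of this preorder together with its ties (i,j), i < j, hence
   a strict partial order. If x violates the edge (i,j), exchanging
   x_i = 1 and x_j = 0 changes x^T Q x by at most S(i,j) <= 0, and moves a one
   upwards in that order; a minimizer whose ones are placed as high as possible
   is therefore ordered. *)
Require Import Defs.
From HB Require Import structures.
From mathcomp Require Import all_boot all_order all_algebra.
From mathcomp Require Import reals lra.

Set Implicit Arguments.
Unset Strict Implicit.
Unset Printing Implicit Defensive.

Import Order.TTheory GRing.Theory Num.Theory.
Local Open Scope ring_scope.

(** By transitivity the head of a cycle is related to every later vertex, hence to itself. *)
Lemma acyclic_strict_order n (E : {set 'I_n * 'I_n}) :
  irreflexive (edge E) -> transitive (edge E) -> acyclic E.
Proof.
move=> irrE trE [//|i c] _; apply/negP => /= /(order_path_min trE).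
by rewrite all_rcons irrE.
Qed.

(** * Validity from exchanges that do not increase the objective *)

Section ExchangeArgument.
Variables (R : realType) (n : nat) (phi : 'cV[bool]_n -> R).
Variable E : {set 'I_n * 'I_n}.

Definition exchange (i j : 'I_n) (x : 'cV[bool]_n) : 'cV[bool]_n :=
  \col_k (if k == i then x j 0 else if k == j then x i 0 else x k 0).

Hypotheses (irrE : irreflexive (edge E)) (trE : transitive (edge E)).
Hypothesis phi_exchange : forall (i j : 'I_n) (x : 'cV[bool]_n), (i, j) \in E ->
  x i 0 -> ~~ x j 0 -> phi (exchange i j x) <= phi x.

(** A numerical rank for the order; its sum over the ones of a vector is the potential that
    exchanges increase. *)
Definition height (i : 'I_n) : nat := #|[set k | edge E k i]|.

Definition total_height (x : 'cV[bool]_n) : nat :=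
  (\sum_(i | x i 0%R) height i)%N.

(** Predecessors of [i] precede [j] by transitivity; [i] itself precedes [j] but not [i]. *)
Lemma height_lt i j : (i, j) \in E -> (height i < height j)%N.
Proof.
move=> Eij; apply/proper_card/properP; split.
  by apply/subsetP => k; rewrite !inE => /trE; apply.
by exists i; rewrite inE // irrE.
Qed.

Lemma total_height_exchange i j (x : 'cV[bool]_n) : (i, j) \in E -> x i 0 -> ~~ x j 0 ->
  (total_height x < total_height (exchange i j x))%N.
Proof.
move=> Eij xi xj; have ij : i != j by apply: contraNneq xj => <-.
rewrite /total_height (bigD1 i) //= [ltnRHS](bigD1 j) /=; last first.
  by rewrite mxE eq_sym (negPf ij) eqxx.
(* With the one at [i] split off on the left and the one at [j] on the right, the remaining sums
   agree. *)
rewrite -addSn; apply: leq_add; first exact: height_lt.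
rewrite leq_eqVlt; apply/orP; left; apply/eqP/eq_bigl => k; rewrite mxE.
case: (eqVneq k i) => [->|_]; first by rewrite (negPf xj) andbF.
by case: (eqVneq k j) => [->|_]; rewrite ?(negPf xj) ?andbF.
Qed.

Lemma valid_order_exchange : valid_order E phi.
Proof.
pose x0 : 'cV[bool]_n := const_mx false.
case: (@arg_minP _ _ _ x0 predT phi isT) => m _ min_m.
case: (@arg_maxnP _ m [pred x | phi x == phi m] total_height (eqxx _)).
move=> x /= /eqP phix max_x; exists (phi m); split; first last.
  split=> [|y _]; last exact: min_m.
  exists x => //; rewrite inE; apply/forallP => i; apply/forallP => j.
  apply/implyP => Eij; apply/implyP => xi; apply: contraT => xj.
  (* The exchanged vector is again a minimizer, so its greater height contradicts the choice of
     [x]. *)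
  have := max_x (exchange i j x).
  rewrite /= eq_le min_m // -{1}phix phi_exchange //= => /(_ isT).
  by rewrite leqNgt total_height_exchange.
by split=> [|y _]; [exists m; rewrite ?inE | exact: min_m].
Qed.

End ExchangeArgument.

(** * Effect of an exchange on the quadratic form *)

Section QuadraticForm.
Variables (R : realType) (n : nat) (Q : 'M[R]_n).
Implicit Types (i j k : 'I_n) (w : 'cV[R]_n).

Local Notation a := (Q + Q^T).

Definition exchange_bound i j : R :=
  Q j j - Q i i
  + \sum_(k | (k != i) && (k != j)) Num.max 0 (a j k - a i k).

Lemma sym_coeffC i j : a i j = a j i.
Proof. by rewrite !mxE addrC. Qed.

(** By bilinearity; the cross terms with [Q i k] and [Q k i] combine into [a i k]. *)
Lemma form_add_delta w i :
  ((w + delta_mx i 0)^T *m Q *m (w + delta_mx i 0)) 0 0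
  = (w^T *m Q *m w) 0 0 + \sum_k a i k * w k 0 + Q i i.
Proof.
set e : 'cV[R]_n := delta_mx i 0.
have wQe : (w^T *m Q *m e) 0 0 = \sum_k Q k i * w k 0.
  by rewrite /e -colE !mxE; apply: eq_bigr => k _; rewrite mxE mulrC.
have eQw : ((e)^T *m Q *m w) 0 0 = \sum_k Q i k * w k 0.
  by rewrite /e trmx_delta -rowE mxE; apply: eq_bigr => k _; rewrite mxE.
have eQe : ((e)^T *m Q *m e) 0 0 = Q i i.
  by rewrite /e trmx_delta -rowE -colE !mxE.
have -> : \sum_k a i k * w k 0
    = (\sum_k Q i k * w k 0) + \sum_k Q k i * w k 0.
  by rewrite -big_split; apply: eq_bigr => k _; rewrite !mxE mulrDl.
rewrite [(_ + _)^T]linearD /= !mulmxDl !mulmxDr.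
have entryD (A B : 'M[R]_1) : (A + B) 0 0 = A 0 0 + B 0 0 by rewrite mxE.
by rewrite !entryD -wQe -eQw -eQe; lra.
Qed.

Lemma quad_form_exchange i j (x : 'cV[bool]_n) : x i 0 -> ~~ x j 0 ->
  quad_form Q (exchange i j x) <= quad_form Q x + exchange_bound i j.
Proof.
move=> xi xj; have ij : i != j by apply: contraNneq xj => <-.
(* [w] is [x] with entries [i] and [j] cleared: [x] adds the unit vector at [i] to it, the exchanged
   vector the one at [j]. *)
pose w : 'cV[R]_n :=
  \col_k (if (k != i) && (k != j) then (x k 0)%:R else 0).
have xE : map_mx (fun b : bool => b%:R) x = w + delta_mx i 0.
  apply/colP => k; rewrite !mxE andbT.
  case: (eqVneq k i) => [->|_] /=; first by rewrite xi add0r.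
  by case: (eqVneq k j) => [->|_] /=; rewrite ?(negPf xj) addr0.
have yE : map_mx (fun b : bool => b%:R) (exchange i j x) = w + delta_mx j 0.
  apply/colP => k; rewrite !mxE andbT.
  case: (eqVneq k i) => [->|_] /=.
    by rewrite (negPf ij) (negPf xj) addr0.
  by case: (eqVneq k j) => [->|_] /=; rewrite ?xi ?add0r ?addr0.
rewrite /quad_form xE yE !form_add_delta.
suff : \sum_k a j k * w k 0 - \sum_k a i k * w k 0
   <= \sum_(k | (k != i) && (k != j)) Num.max 0 (a j k - a i k).
  by rewrite /exchange_bound; lra.
(* Each [w k 0] is 0 or 1, and 0 at [i] and [j], so positive parts bound the difference termwise. *)
rewrite -sumrB [leRHS]big_mkcond /=; apply: ler_sum => k _.
rewrite -mulrBl [w k 0]mxE; case: ifP => _; last by rewrite mulr0.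
by case: (x k 0); rewrite ?mulr1 ?mulr0 le_max lexx ?orbT.
Qed.

(** * The preorder of domination and its strict order *)

Lemma exchange_boundxx i : exchange_bound i i = 0.
Proof.
rewrite /exchange_bound subrr add0r big1 // => k _.
by rewrite subrr maxxx.
Qed.

Lemma exchange_bound_diag i j : exchange_bound i j <= 0 -> Q j j <= Q i i.
Proof.
rewrite /exchange_bound => b_le0; rewrite -subr_le0; apply: le_trans b_le0.
by rewrite lerDl sumr_ge0 // => k _; rewrite le_max lexx.
Qed.

Lemma max0D (u v : R) : Num.max 0 (u + v) <= Num.max 0 u + Num.max 0 v.
Proof. by rewrite ge_max addr_ge0 ?lerD // le_max lexx ?orbT. Qed.

(** The diagonal terms telescope. Each sum gives up the one index among [i], [j], [l] that it
    contains; what remains runs over a common range, where the positive part is subadditive. *)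
Lemma exchange_bound_triangle i j l : i != j -> j != l -> i != l ->
  exchange_bound i l <= exchange_bound i j + exchange_bound j l.
Proof.
move=> ij jl il; rewrite /exchange_bound.
rewrite (bigD1 j) /=; last by rewrite eq_sym ij.
rewrite [in leRHS](bigD1 l) /=; last by rewrite eq_sym il eq_sym.
rewrite [X in _ + (_ + X)](bigD1 i) /=; last by rewrite ij.
pose T := [pred k | [&& k != i, k != j & k != l]].
rewrite (eq_bigl T) => [|k]; last by rewrite /= -andbA [(k != l) && _]andbC.
rewrite [X in _ + (_ + X) + _](eq_bigl T) => [|k]; last by rewrite /= -andbA.
rewrite [X in _ + (_ + (_ + X))](eq_bigl T) => [|k]; last first.
  by rewrite /= [RHS]andbC.
have tail : \sum_(k | T k) Num.max 0 (a l k - a i k)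
    <= \sum_(k | T k) Num.max 0 (a j k - a i k)
       + \sum_(k | T k) Num.max 0 (a l k - a j k).
  rewrite -big_split /=; apply: ler_sum => k _.
  have -> : a l k - a i k = (a j k - a i k) + (a l k - a j k) by lra.
  exact: max0D.
have head : Num.max 0 (a l j - a i j)
    <= Num.max 0 (a j l - a i l) + Num.max 0 (a l i - a j i).
  (* By symmetry of [a], the two occurrences of [a i l] cancel. *)
  rewrite [a l j]sym_coeffC [a l i]sym_coeffC [a j i]sym_coeffC.
  apply: le_trans (max0D _ _).
  by rewrite addrA subrK.
lra.
Qed.

Definition dominates i j := exchange_bound i j <= 0.

Lemma dominates_trans : transitive dominates.
Proof.
move=> j i l; rewrite /dominates.
have [->//|ij] := eqVneq i j; have [->//|jl] := eqVneq j l.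
have [->|il] := eqVneq i l; first by rewrite exchange_boundxx.
by have := exchange_bound_triangle ij jl il; lra.
Qed.

(** Ties go to the smaller index, whose row the outer loop treats first. *)
Definition precedes i j := dominates i j && (dominates j i ==> (i < j)%N).

Lemma precedes_irr : irreflexive precedes.
Proof.
by move=> i; rewrite /precedes /dominates exchange_boundxx lexx ltnn.
Qed.

(** If [l] dominates [i], all three are tied and the indices increase. *)
Lemma precedes_trans : transitive precedes.
Proof.
move=> j i l /andP[ij /implyP ji] /andP[jl /implyP lj].
rewrite /precedes (dominates_trans ij jl); apply/implyP => li.
exact: ltn_trans (ji (dominates_trans jl li)) (lj (dominates_trans li ij)).
Qed.

(** * Closed form of the output of the algorithm *)

Lemma scan_le0 (b : 'M[R]_n) i j (s : R) (ks : seq 'I_n) :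
  (scan b i j s ks <= 0)
  = (s + \sum_(k <- ks | (k != i) && (k != j)) Num.max 0 (b j k - b i k) <= 0).
Proof.
elim: ks s => [|k ks IH] s /=; first by rewrite big_nil addr0.
rewrite big_cons; case: (k != i) => //=; case: (k != j) => //=.
have [lt_b|le_b] := ltP (b i k) (b j k); last first.
  by rewrite IH max_l ?add0r // subr_le0.
rewrite max_r; last by rewrite subr_ge0 ltW.
rewrite !addrA; case: ltP => [s_gt0|_]; last by rewrite IH.
(* After an early exit the skipped terms are nonnegative, so the full sum is positive too. *)
rewrite [LHS]leNgt s_gt0.
apply/esym/negbTE; rewrite -ltNge ltr_wpDr // sumr_ge0 // => l _.
by rewrite le_max lexx.
Qed.

(** When [i] dominates [j], the hypothesis says that the reverse edge is present exactly for a tie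
    with [j < i]. *)
Lemma extraction_stepE i j (E : {set 'I_n * 'I_n}) :
  ((j, i) \in E) = (j < i)%N && precedes j i ->
  extraction_step Q i E j = if precedes i j then (i, j) |: E else E.
Proof.
move=> Eji; rewrite /extraction_step scan_le0 big_enum_cond /=.
rewrite -/(exchange_bound i j) -/(dominates i j) Eji.
have [->|ij] := eqVneq i j; first by rewrite precedes_irr.
rewrite /precedes; have [dij|_] /= := boolP (dominates i j); last by case: ifP.
rewrite (exchange_bound_diag dij) andbT.
by case: (dominates j i); case: ltngtP ij => //= /val_inj ->; rewrite eqxx.
Qed.

Lemma extraction_rowE i (E : {set 'I_n * 'I_n}) (js : seq 'I_n) :
  (forall j, ((j, i) \in E) = (j < i)%N && precedes j i) ->
  foldl (extraction_step Q i) E js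
  = E :|: [set p | [&& p.1 == i, p.2 \in js & precedes p.1 p.2]].
Proof.
elim: js E => [|j js IH] E E_i /=.
  by apply/setP => -[k l]; rewrite !inE /= andbF orbF.
rewrite extraction_stepE //; have [ij|Nij] := boolP (precedes i j).
  rewrite IH => [|k].
    apply/setP => -[k l]; rewrite !inE /= xpair_eqE.
    case: (eqVneq k i) => [->|_] //=; case: (eqVneq l j) => [->|_] //=.
    by rewrite ij orbT.
  (* The new edge leaves [i] and cannot enter it, so the invariant on edges into [i] persists. *)
  rewrite !inE xpair_eqE E_i; case: (eqVneq k i) => [->|] //=.
  by case: (eqVneq i j) ij => [<-|] //=; rewrite precedes_irr.
rewrite IH //; apply/setP => -[k l]; rewrite !inE /=.
case: (eqVneq k i) => [->|_] //=; case: (eqVneq l j) => [->|_] //=.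
by rewrite (negPf Nij) andbF.
Qed.

Lemma order_extractionE : order_extraction Q = [set p | precedes p.1 p.2].
Proof.
(* Prefixes of the outer loop allow induction on the number [m] of finished rows. *)
rewrite /order_extraction -[X in foldl _ _ X]take_size size_enum_ord.
suff rows m : (m <= n)%N ->
    foldl (fun E i => foldl (extraction_step Q i) E (enum 'I_n)) set0
      (take m (enum 'I_n))
    = [set p : 'I_n * 'I_n | (p.1 < m)%N && precedes p.1 p.2].
  by rewrite rows //; apply/setP => p; rewrite !inE ltn_ord.
elim: m => [_|m IH lt_mn].
  by rewrite take0; apply/setP => p; rewrite !inE.
rewrite (take_nth (Ordinal lt_mn)) ?size_enum_ord // foldl_rcons IH 1?ltnW //.
have -> : nth (Ordinal lt_mn) (enum 'I_n) m = Ordinal lt_mn.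
  exact: nth_ord_enum (Ordinal lt_mn) (Ordinal lt_mn).
(* For row [m], the induction hypothesis is the required invariant. *)
rewrite extraction_rowE => [|j]; last by rewrite inE.
apply/setP => p; rewrite !inE mem_enum -val_eqE /= ltnS.
by rewrite [(p.1 <= m)%N]leq_eqVlt orbC -andb_orl.
Qed.

End QuadraticForm.

Theorem theorem5 (R : realType) (n : nat) (hn : (0 < n)%N) (Q : 'M[R]_n) :
  acyclic (order_extraction Q) /\
  valid_order (order_extraction Q) (quad_form Q).
Proof.
have edgeE : edge (order_extraction Q) =2 precedes Q.
  by move=> i j; rewrite /edge order_extractionE inE.
have irrE : irreflexive (edge (order_extraction Q)).
  by move=> i; rewrite edgeE precedes_irr.
have trE : transitive (edge (order_extraction Q)).
  by move=> j i l; rewrite !edgeE; exact: precedes_trans.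
split; first exact: acyclic_strict_order.
apply: valid_order_exchange => // i j x; rewrite -/(edge _ i j) edgeE.
case/andP=> dij _ xi xj; apply: le_trans (quad_form_exchange Q xi xj) _.
by rewrite gerDl.
Qed.
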